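(* Let $c,d\colon[0,\infty)^2\to[0,\infty)$ and let $Z=\{(r,s)\in(0,\infty)^2\colon d(r,s)=0\}$. Assume that $Z\neq\emptyset$ and $Z\neq(0,\infty)^2$. Let $\varphi,\psi\colon\mathbb{R}\to\mathbb{R}$ be nontrivial characteristic functions satisfying $$\varphi(rt)\varphi(st)=\varphi(c(r,s)t)\,\psi(d(r,s)t)\qquad\text{for all } r,s\ge0,\ t\in\mathbb{R}.$$ Then there exist $p\in(0,2]$ and even continuous functions $H,K\colon\mathbb{R}\setminus\{0\}\to(0,\infty)$ such that $$\varphi(t)=e^{-|t|^pH(t)}\quad\text{and}\quad\psi(t)=e^{-|t|^pK(t)}$$ for every $t\in\mathbb{R}\setminus\{0\}$, and $$H(rt)=H(st)=H(c(r,s)t)\quad\text{and}\quad K(rt)=K(st)=K(c(r,s)t)$$ for every $t\in\mathbb{R}\setminus\{0\}$ and $(r,s)\in Z$. Moreover, $$r^pH(rt)+s^pH(st)=c(r,s)^pH(c(r,s)t)+d(r,s)^pK(d(r,s)t)$$ for every $t\in\mathbb{R}\setminus\{0\}$ and all $r,s>0$ such that $c(r,s)>0$ and $(r,s)\notin Z$.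
   Context: A characteristic function is the Fourier transform $t\mapsto\int_{\mathbb{R}} e^{itx}\nu(dx)$ of a probability measure $\nu$ on $\mathbb{R}$; here the characteristic functions are real-valued. Nontrivial means not identically equal to $1$. *)

(* Defs.v *)
From HB Require Import structures.
From mathcomp Require Import all_boot all_order all_algebra.
From mathcomp Require Import complex.
From mathcomp Require Import all_classical all_reals all_analysis.

Set Implicit Arguments.
Unset Strict Implicit.
Unset Printing Implicit Defensive.

Import Order.TTheory GRing.Theory Num.Theory.
Import numFieldNormedType.Exports.

Local Open Scope classical_set_scope.
Local Open Scope ring_scope.
Local Open Scope complex_scope.

(* The Lebesgue integral is real-valued only, so e^{itx} is integrated through
   its real part cos (tx) and imaginary part sin (tx); both are bounded, hence
   integrable for a probability measure, and Rintegral takes no junk value. *)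
Definition char_fun (R : realType) (nu : probability (measurableTypeR R) R)
    (t : R) : R[i] :=
  (\int[nu]_(x in setT) cos (t * x)) +i* (\int[nu]_(x in setT) sin (t * x)).

Definition is_real_char_fun (R : realType) (phi : R -> R) : Prop :=
  exists nu : probability (measurableTypeR R) R,
    forall t : R, char_fun nu t = (phi t)%:C.

Definition quadrant (R : realType) : set (R * R) :=
  [set rs | 0 < rs.1 /\ 0 < rs.2].

Definition zero_locus (R : realType) (d : R -> R -> R) : set (R * R) :=
  [set rs | quadrant rs /\ d rs.1 rs.2 = 0].

(* Main.v *)
(* A point of [Z] gives [phi t = phi (a * t) * phi (b * t)] with scales [a], [b]
   which nontriviality forces into [(0, 1)]; hence [phi > 0], and [f = - ln phi]
   solves [f t = f (a * t) + f (b * t)].  Choosing [p] with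
   [a `^ p + b `^ p = 1], a theorem of Deny type gives
   [f (a * t) = a `^ p * f t].  Its proof views
   [F k l = f (a ^+ k * b ^+ l * t)] as a positive harmonic function on the
   lattice [nat * nat]: since ['C(k + l, k) * F k l <= F 0 0], following a path
   of nearly modal binomial weights bounds [f s] by [s `^ p] up to a factor
   logarithmic in [s], so that the weights ['C(n, k) * F k (n - k)] concentrate
   at [k / n = a `^ p].  By continuity [f] is then comparable to [t `^ p], so
   [p] does not depend on the point of [Z], and
   [1 - phi (2 * t) <= 4 * (1 - phi t)] forces [p <= 2].
   A point outside [Z] expresses [- ln psi] through [f], so that it inherits the
   scaling relations of [f]. *)

Require Import Defs.
From HB Require Import structures.
From mathcomp Require Import all_boot all_order all_algebra.
From mathcomp Require Import complex.
From mathcomp Require Import all_classical all_reals all_analysis.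
From mathcomp Require Import measurable_realfun ring lra.

Import Order.TTheory GRing.Theory Num.Theory.
Import numFieldNormedType.Exports.

Local Open Scope classical_set_scope.
Local Open Scope ring_scope.

(** * Real characteristic functions *)

Section real_characteristic_functions.
Context {R : realType}.
Implicit Types (phi : R -> R) (nu : probability (measurableTypeR R) R).

Lemma cosMr_continuous (x : R) : continuous (fun t : R => cos (t * x)).
Proof.
move=> t; apply: continuous_comp; last exact: continuous_cos.
exact: mulrr_continuous.
Qed.

Lemma integrable_cosM nu (t : R) :
  nu.-integrable setT (EFin \o (fun x : R => cos (t * x))).
Proof.
apply: measurable_bounded_integrable => //.
- exact: (le_lt_trans (probability_le1 nu measurableT) (ltry _)).
- apply: continuous_measurable_fun.
  by under eq_fun do rewrite mulrC; exact: cosMr_continuous.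
- exists 1; split; first exact: num_real.
  by move=> M M1 x _ /=; rewrite (le_trans (cos_max _))// ltW.
Qed.

Lemma Rintegral_prob1 nu : \int[nu]_(x in setT) (1 : R) = 1.
Proof.
rewrite Rintegral_cst// mul1r.
rewrite [X in fine X](_ : _ = 1%E)//; exact: (@probability_setT _ _ _ nu).
Qed.

Lemma real_char_funE {phi} : is_real_char_fun phi ->
  exists nu, forall t, phi t = \int[nu]_(x in setT) cos (t * x).
Proof. by case=> nu nuE; exists nu => t; have [->] := nuE t. Qed.

Lemma char_fun0 {phi} : is_real_char_fun phi -> phi 0 = 1.
Proof.
move=> /real_char_funE[nu ->].
under eq_Rintegral do rewrite mul0r cos0.
exact: Rintegral_prob1.
Qed.

Lemma char_fun_norm_le1 {phi} : is_real_char_fun phi -> forall t, `|phi t| <= 1.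
Proof.
move=> /real_char_funE[nu phiE] t; rewrite phiE.
have int1 : nu.-integrable setT (EFin \o (fun=> 1 : R)).
  exact: finite_measure_integrable_cst.
have intc := integrable_cosM nu t.
rewrite ler_norml -(Rintegral_prob1 nu); apply/andP; split.
  rewrite -subr_ge0 opprK -RintegralD//.
  by apply: Rintegral_ge0 => x _; rewrite -lerBlDr sub0r cos_geN1.
by apply: le_Rintegral => // x _; rewrite cos_le1.
Qed.

Lemma char_funN {phi} : is_real_char_fun phi -> forall t, phi (- t) = phi t.
Proof.
move=> /real_char_funE[nu phiE] t; rewrite !phiE.
by apply: eq_Rintegral => x _; rewrite mulNr cosN.
Qed.

Lemma char_fun_continuous {phi} : is_real_char_fun phi -> continuous phi.
Proof.
move=> /real_char_funE[nu phiE] t.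
have -> : phi = fun s => \int[nu]_(x in setT) cos (s * x).
  by apply/funext => s; rewrite phiE.
apply: (@continuity_under_integral R _ _ nu (fun s x => cos (s * x)) setT
  measurableT (t - 1) (t + 1) _ _ (fun=> 1)).
- by move=> s _; exact: integrable_cosM.
- apply: aeW => x _ s _.
  exact: cosMr_continuous.
- exact: finite_measure_integrable_cst.
- by move=> s _; apply: aeW => x _; exact: cos_max.
- by rewrite inE/= in_itv/=; lra.
Qed.

(** Since [1 - cos z = 2 * sin (z / 2) ^+ 2], this is the addition formula for [sin] followed by
    [(x + y)^2 <= 2 x^2 + 2 y^2] and [cos^2 <= 1]. *)
Lemma one_sub_cosD_le (x y : R) :
  1 - cos (x + y) <= 2 * (1 - cos x) + 2 * (1 - cos y).
Proof.
have half (z : R) : 1 - cos z = 2 * sin (z / 2) ^+ 2.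
  have {1}-> : z = (z / 2) *+ 2 by rewrite -mulr_natr divfK ?pnatr_eq0.
  by rewrite cos_mulr2n cos2sin2 !mulr2n; ring.
rewrite !half [_ / 2]mulrDl sinD.
have := cos2Dsin2 (x / 2); have := cos2Dsin2 (y / 2).
move: (sin (x / 2)) (cos (x / 2)) (sin (y / 2)) (cos (y / 2)) => a b c d.
move=> /(canRL (addrK _)) d2 /(canRL (addrK _)) b2.
apply: (@le_trans _ _ (2 * (2 * (a * d) ^+ 2 + 2 * (b * c) ^+ 2))).
  rewrite ler_pM2l// -subr_ge0.
  rewrite (_ : _ - _ = (a * d - b * c) ^+ 2) ?sqr_ge0//; ring.
rewrite !exprMn d2 b2.
have := mulr_ge0 (sqr_ge0 a) (sqr_ge0 c); lra.
Qed.

(** The cosine inequality integrated against [nu]. It makes the set where [phi = 1] stable under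
    addition and, at [s = t], limits the decay of [1 - phi] under halving. *)
Lemma one_sub_char_funD_le {phi} : is_real_char_fun phi ->
  forall s t, 1 - phi (s + t) <= 2 * (1 - phi s) + 2 * (1 - phi t).
Proof.
move=> /real_char_funE[nu phiE] s t; rewrite !phiE.
have int1 : nu.-integrable setT (EFin \o (fun=> 1 : R)).
  exact: finite_measure_integrable_cst.
have intB u : nu.-integrable setT (EFin \o (fun x : R => 1 - cos (u * x))).
  exact: (integrableB measurableT int1 (integrable_cosM nu u)).
have intM u :
    nu.-integrable setT (EFin \o (fun x : R => 2 * (1 - cos (u * x)))).
  exact: (integrableZl measurableT 2 (intB u)).
have E u : 1 - \int[nu]_(x in setT) cos (u * x) =
    \int[nu]_(x in setT) (1 - cos (u * x)).
  by rewrite -{1}(Rintegral_prob1 nu) -RintegralB//; exact: integrable_cosM.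
rewrite !E -!RintegralZl// -RintegralD//; apply: le_Rintegral => //.
  exact: (integrableD measurableT (intM s) (intM t)).
by move=> x _; rewrite mulrDl one_sub_cosD_le.
Qed.

(** Doubling preserves [phi s = 1], and every [t] is reached by doublings from some [t / 2 ^+ n] in
    the neighbourhood. *)
Lemma char_fun_near0_trivial {phi} : is_real_char_fun phi ->
  (\forall t \near 0, phi t = 1) -> forall t, phi t = 1.
Proof.
move=> phiC /nbhs_ballP[e /= e0 phi1] t.
have [n tn] : exists n, `|t / 2 ^+ n| < e.
  have /cvgrPdist_lt/(_ e e0)[n _ /(_ n (leqnn _))] :
      t * (2^-1) ^+ n @[n --> \oo] --> (0 : R).
    rewrite -(mulr0 t); apply: cvgM; first exact: cvg_cst.
    by apply: cvg_expr; rewrite ger0_norm ?invr_ge0// invf_lt1// ltr1n.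
  by rewrite /= sub0r normrN exprVn; exists n.
have : phi (t / 2 ^+ n) = 1.
  by apply: phi1; rewrite /= /ball/= sub0r normrN.
elim: n {tn} => [|n IHn]; first by rewrite expr0 divr1.
set s := t / 2 ^+ n.+1 => phis; apply: IHn.
have -> : t / 2 ^+ n = s + s.
  by rewrite /s exprS; field; rewrite expf_neq0.
have := one_sub_char_funD_le phiC s s; rewrite phis subrr mulr0 addr0 subr_le0.
move=> phige; apply/eqP; rewrite eq_le phige andbT.
by rewrite (le_trans (ler_norm _))// char_fun_norm_le1.
Qed.

(** The points where [phi = 1] form a closed subgroup of the line, which contains the arbitrarily
    small nonzero [a ^+ n * t0]. *)
Lemma char_fun_eq1_scaled {phi} (a t0 : R) : is_real_char_fun phi ->
    0 < a -> a < 1 -> t0 != 0 -> phi t0 = 1 ->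
    (forall t, phi t = 1 -> phi (a * t) = 1) ->
  forall t, phi t = 1.
Proof.
move=> phiC a0 a1 t0N0 phit0 phia t.
have phiD s s' : phi s = 1 -> phi s' = 1 -> phi (s + s') = 1.
  move=> s1 s'1; have := one_sub_char_funD_le phiC s s'.
  rewrite s1 s'1 subrr mulr0 addr0 subr_le0 => phige.
  by apply/eqP; rewrite eq_le phige andbT (le_trans (ler_norm _))//
    char_fun_norm_le1.
have phiz s (z : int) : phi s = 1 -> phi (z%:~R * s) = 1.
  move=> s1; have phin (n : nat) : phi (n%:R * s) = 1.
    elim: n => [|n IHn]; first by rewrite mul0r char_fun0.
    by rewrite -natr1 mulrDl mul1r phiD.
  case: z => n; first exact: phin.
  by rewrite NegzE mulrNz mulNr char_funN//; exact: phin.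
have phian n : phi (a ^+ n * t0) = 1.
  by elim: n => [|n IHn]; rewrite ?mul1r// exprS -mulrA phia.
(* [t] is the limit of its roundings to multiples of [a ^+ n * t0]. *)
pose q n : R := a ^+ n * t0.
have qN0 n : q n != 0 by rewrite mulf_neq0 ?expf_neq0// gt_eqF.
pose w n : R := (Num.floor (t / q n))%:~R * q n.
have wt : w n @[n --> \oo] --> t.
  apply/cvgrPdist_le => e e0.
  have : q n @[n --> \oo] --> (0 : R).
    rewrite -(mul0r t0); apply: cvgM; last exact: cvg_cst.
    by apply: cvg_expr; rewrite gtr0_norm.
  move/cvgrPdist_le => /(_ e e0); apply: filterS => n.
  rewrite sub0r normrN; apply: le_trans.
  rewrite /w -{1}[t](divfK (qN0 n)) -mulrBl normrM ler_piMl//.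
  have /andP[fl fr] := floor_itv (t / q n); move: fr; rewrite intrD => fr.
  by rewrite ger0_norm ?subr_ge0// lerBlDl ltW.
have : phi (w n) @[n --> \oo] --> phi t.
  exact: (cvg_comp _ _ wt (char_fun_continuous phiC t)).
have -> : (fun n => phi (w n)) = fun=> 1.
  by apply/funext => n; apply/phiz/phian.
by move/cvg_lim => <-//; rewrite lim_cst.
Qed.

End real_characteristic_functions.

(** * Binomial sums and harmonic functions on the lattice *)

Section binomial_sums.
Context {R : realType}.
Implicit Types (F G : nat -> nat -> R).

(** The binomial coefficient counts lattice paths from the origin to [(k, n - k)], so [G] is summed
    over the endpoints of all paths of length [n]. *)
Definition binsum n G : R := \sum_(k < n.+1) 'C(n, k)%:R * G k (n - k)%N.

Lemma binsumS n G :
  binsum n.+1 G = binsum n (fun k l => G k.+1 l + G k l.+1).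
Proof.
rewrite /binsum.
under [RHS]eq_bigr do rewrite mulrDr.
rewrite big_split [LHS]big_ord_recl/= bin0 subn0 mul1r.
under [X in _ + X = _]eq_bigr do rewrite /bump/= add1n binS natrD mulrDl subSS.
rewrite big_split/= addrA [RHS]addrC; congr (_ + _).
rewrite big_ord_recr/= bin_small// mul0r addr0.
rewrite [RHS]big_ord_recl/= bin0 subn0 mul1r; congr (_ + _).
by apply: eq_bigr => i _; rewrite /bump/= add1n subnSK.
Qed.

Lemma binsum0 G : binsum 0 G = G 0%N 0%N.
Proof. by rewrite /binsum big_ord1 mul1r. Qed.

Lemma eq_binsum n F G : (forall k l, (k + l = n)%N -> F k l = G k l) ->
  binsum n F = binsum n G.
Proof.
move=> FG; apply: eq_bigr => k _; rewrite FG// subnKC//.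
by rewrite -ltnS.
Qed.

Lemma binsumD n F G :
  binsum n (fun k l => F k l + G k l) = binsum n F + binsum n G.
Proof. by rewrite -big_split; apply: eq_bigr => k _; rewrite mulrDr. Qed.

Lemma binsumZ n (x : R) G : binsum n (fun k l => x * G k l) = x * binsum n G.
Proof. by rewrite mulr_sumr; apply: eq_bigr => k _; rewrite mulrCA. Qed.

Lemma ler_binsum n F G : (forall k l, (k + l = n)%N -> F k l <= G k l) ->
  binsum n F <= binsum n G.
Proof.
move=> FG; apply: ler_sum => k _; rewrite ler_wpM2l// FG// subnKC//.
by rewrite -ltnS.
Qed.

Definition lattice_harmonic F :=
  forall k l, F k l = F k.+1 l + F k l.+1.

Lemma binsum_harmonic n F : lattice_harmonic F -> binsum n F = F 0%N 0%N.
Proof.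
move=> hF; elim: n => [|n IHn]; first exact: binsum0.
by rewrite binsumS -IHn; apply: eq_binsum => k l _; rewrite -hF.
Qed.

(** For non-negative [F], the terms ['C(n, k) * F k (n - k)] are the masses of the number [k] of
    first-coordinate steps in an exchangeable walk; each of the [n] steps contributes [F 1 0] to the
    first moment. *)
Lemma binsum_natM_harmonic n F : lattice_harmonic F ->
  binsum n (fun k l => k%:R * F k l) = n%:R * F 1%N 0%N.
Proof.
elim: n F => [|n IHn] F hF; first by rewrite binsum0 !mul0r.
have hFS : lattice_harmonic (fun k l => F k.+1 l) by move=> k l; exact: hF.
rewrite binsumS -natr1 mulrDl mul1r -(IHn _ hF) -(binsum_harmonic n _ hFS).
rewrite -binsumD.
by apply: eq_binsum => k l _; rewrite [F k l]hF -natr1; ring.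
Qed.

Lemma harmonic_bin_le F k l : lattice_harmonic F -> (forall i j, 0 <= F i j) ->
  'C(k + l, k)%:R * F k l <= F 0%N 0%N.
Proof.
move=> hF F0; rewrite -(binsum_harmonic (k + l) _ hF) /binsum.
have kl : (k < (k + l).+1)%N by rewrite ltnS leq_addr.
rewrite (bigD1 (Ordinal kl))//= addKn lerDl sumr_ge0// => i _.
by rewrite mulr_ge0.
Qed.

(** * Central moments and mode of the binomial distribution *)

Context (u v : R) (u0 : 0 < u) (v0 : 0 < v) (uv : u + v = 1).

Let B k l : R := u ^+ k * v ^+ l.

(* [v * k - u * l] is the centred count [k - u * n] when [k + l = n]. *)
Let centred n j := binsum n (fun k l => B k l * (v * k%:R - u * l%:R) ^+ j).

Let centred0 j : centred 0 j = (j == 0%N)%:R.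
Proof. by rewrite /centred binsum0 /B !expr0 !mulr0 subrr !mul1r expr0n. Qed.

Let centredS0 n : centred n.+1 0 = centred n 0.
Proof.
rewrite /centred binsumS; apply: eq_binsum => k l _.
by rewrite /B !expr0 !exprS -[RHS]mul1r -uv; ring.
Qed.

Let centredS1 n : centred n.+1 1 = centred n 1.
Proof.
rewrite /centred binsumS; apply: eq_binsum => k l _.
by rewrite /B -!natr1 !expr1 !exprS -[RHS]mul1r -uv; ring.
Qed.

Let vE : v = 1 - u. Proof. by rewrite -uv addrAC subrr add0r. Qed.

Let centredS2 n : centred n.+1 2 = centred n 2 + u * v * centred n 0.
Proof.
rewrite /centred binsumS -binsumZ -binsumD; apply: eq_binsum => k l _.
by rewrite /B -!natr1 !exprS !expr0 vE; ring.
Qed.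

(** One more step adds [v] with weight [u] or [- u] with weight [v]; the coefficients are [6], [4],
    [1] times the second, third and fourth moments of this centred increment. *)
Let centredS4 n : centred n.+1 4 = centred n 4 + 6 * (u * v) * centred n 2
  + 4 * (u * v * (v - u)) * centred n 1
  + (u * v * (v ^+ 3 + u ^+ 3)) * centred n 0.
Proof.
rewrite /centred binsumS -!binsumZ -!binsumD; apply: eq_binsum => k l _.
by rewrite /B -!natr1 !exprS !expr0 vE; ring.
Qed.

(** By the recursion each step adds at most [6 * n + 2], below the increment [14 * n + 7] of
    [7 * n ^ 2]. *)
Lemma binsum_centred4_le n :
  binsum n (fun k l => u ^+ k * v ^+ l * (v * k%:R - u * l%:R) ^+ 4) <=
  7 * n%:R ^+ 2.
Proof.
rewrite -/(centred n 4).
have c0 m : centred m 0 = 1.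
  by elim: m => [|m IHm]; rewrite ?centred0// centredS0.
have c1 m : centred m 1 = 0.
  by elim: m => [|m IHm]; rewrite ?centred0// centredS1.
have c2 m : centred m 2 = u * v * m%:R.
  elim: m => [|m IHm]; first by rewrite centred0 mulr0.
  by rewrite centredS2 IHm c0 -natr1; ring.
have uv0 : 0 <= u * v by rewrite mulr_ge0 ?ltW.
have uv1 : u * v <= 1.
  by rewrite -[leRHS]mulr1 ler_pM ?ltW// -uv ?ltrDl ?ltrDr.
have u1 : u <= 1 by rewrite -uv lerDl ltW.
have v1 : v <= 1 by rewrite -uv lerDr ltW.
elim: n => [|n IHn]; first by rewrite centred0 expr0n mulr0.
rewrite centredS4 c0 c1 c2 mulr0 addr0 mulr1 -(natr1 n).
have n0 : 0 <= n%:R :> R by [].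
have A1 : 6 * (u * v) * (u * v * n%:R) <= 6 * n%:R.
  rewrite mulrA -(mulrA 6) ler_wpM2r// ler_piMr//.
  by rewrite -[leRHS]mulr1 ler_pM.
have A2 : u * v * (v ^+ 3 + u ^+ 3) <= 2.
  have vu3 : v ^+ 3 + u ^+ 3 <= 2.
    by rewrite -[2]/(1 + 1) lerD// exprn_ile1// ltW.
  have vu30 : 0 <= v ^+ 3 + u ^+ 3 by rewrite addr_ge0// exprn_ge0// ltW.
  by rewrite -[leRHS]mul1r ler_pM.
move: IHn A1 A2; move: (6 * _ * _) (_ * _ * (_ + _)) => x y.
by rewrite sqrrD expr1n mulr1; lra.
Qed.

(* A step to [(k.+1, l)] multiplies the weighted term by [u * (n + 2) / (k + 1)]
   and a step to [(k, l.+1)] by [v * (n + 2) / (l + 1)], where [n = k + l]; one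
   of these factors is at least 1. *)
Lemma bin_weight_step k l :
  let w k l := (k + l).+1%:R * 'C(k + l, k)%:R * (u ^+ k * v ^+ l) in
  w k l <= w k.+1 l \/ w k l <= w k l.+1.
Proof.
move=> w.
have wk : w k.+1 l * k.+1%:R = w k l * (u * (k + l).+2%:R).
  rewrite /w addSn.
  have : k.+1%:R * 'C((k + l).+1, k.+1)%:R
       = (k + l).+1%:R * 'C(k + l, k)%:R :> R.
    by rewrite -!natrM -mul_bin_diag.
  rewrite exprS; move: ('C(_, _)%:R) ('C(_, _)%:R) => x y xy.
  transitivity ((k + l).+2%:R * (k.+1%:R * y) * (u * u ^+ k * v ^+ l)).
    by ring.
  by rewrite xy; ring.
have wl : w k l.+1 * l.+1%:R = w k l * (v * (k + l).+2%:R).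
  rewrite /w addnS.
  have : l.+1%:R * 'C((k + l).+1, k)%:R
       = (k + l).+1%:R * 'C(k + l, k)%:R :> R.
    rewrite -!natrM -[(k + l).+1]addnS.
    rewrite -bin_sub ?leq_addr// addKn addnS -mul_bin_diag.
    by rewrite -[in RHS]bin_sub ?leq_addr// addKn.
  rewrite exprS; move: ('C(_, _)%:R) ('C(_, _)%:R) => x y xy.
  transitivity ((k + l).+2%:R * (l.+1%:R * y) * (u ^+ k * (v * v ^+ l))).
    by ring.
  by rewrite xy; ring.
have w0 : 0 <= w k l by rewrite !mulr_ge0// exprn_ge0// ltW.
have [uk|uk] := leP (k.+1%:R) (u * (k + l).+2%:R).
  by left; rewrite -(@ler_pM2r _ k.+1%:R)// wk ler_wpM2l.
right; rewrite -(@ler_pM2r _ l.+1%:R)// wl ler_wpM2l//.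
have := uk; rewrite vE mulrBl mul1r.
by rewrite -addnS -addSn natrD; lra.
Qed.

End binomial_sums.

(** * The functional equation [f t = f (a * t) + f (b * t)] *)

Section deny.
Context {R : realType}.

(** The masses ['C(n, k) * F k (n - k)] have first moment [n * F 1 0]. The growth bound dominates
    them by the binomial law up to a factor linear in [n], so they concentrate near [k = u * n], and
    the first moment must agree. *)
Lemma harmonic_moderate_growth (F : nat -> nat -> R) (u v C : R) (D : nat) :
    0 < u -> 0 < v -> u + v = 1 -> lattice_harmonic F ->
    (forall k l, 0 <= F k l) ->
    (forall k l, F k l <= C * (D * (k + l)).+1%:R * (u ^+ k * v ^+ l)) ->
  F 1%N 0%N = u * F 0%N 0%N.
Proof.
move=> u0 v0 uv hF F0 FC; apply/eqP; rewrite -subr_eq0 -normr_le0.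
have C0 : 0 <= C by have := FC 0%N 0%N; rewrite muln0 !mulr1; exact: le_trans.
set x := `|_|.
(* Chebyshev's inequality with the fourth moment, since the second moment only
   compensates the linear loss in the growth bound. *)
have key (e : R) n : 0 < e ->
    x <= e * F 0%N 0%N + 7 * C * D.+1%:R / e ^+ 3 / n.+1%:R.
  move=> e0; set m : R := n.+1%:R.
  have m0 : 0 < m by rewrite ltr0n.
  pose z k l : R := v * k%:R - u * l%:R.
  (* On [k + l = n.+1] one has [z k l = k - u * n.+1], so its sum against [F] is
     [m * (F 1 0 - u * F 0 0)]. *)
  have mx : m * x <= binsum n.+1 (fun k l => `|z k l| * F k l).
    rewrite -[m]gtr0_norm// -normrM mulrBr -binsum_natM_harmonic//.
    rewrite mulrCA -(binsum_harmonic n.+1 _ hF) -!binsumZ -mulN1r -binsumZ.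
    rewrite -binsumD /binsum (le_trans (ler_norm_sum _ _ _))//.
    apply: ler_sum => k _; rewrite normrM ger0_norm// ler_wpM2l//.
    have kn : (k <= n.+1)%N by rewrite -ltnS.
    rewrite (_ : _ + _ = z k (n.+1 - k)%N * F k (n.+1 - k)%N).
      by rewrite normrM (ger0_norm (F0 _ _)).
    rewrite /z natrB// -/m (_ : v = 1 - u); first by ring.
    by rewrite -uv addrAC subrr add0r.
  have z40 k l : 0 <= z k l ^+ 4 by rewrite exprn_even_ge0.
  have em30 : 0 <= (e * m) ^+ 3 by rewrite exprn_ge0// mulr_ge0// ltW.
  have zle k l : `|z k l| <= e * m + z k l ^+ 4 / (e * m) ^+ 3.
    set y := e * m; have y0 : 0 < y by rewrite mulr_gt0.
    have [zy|yz] := leP `|z k l| y.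
      by rewrite (le_trans zy)// lerDl divr_ge0.
    rewrite (@le_trans _ _ (z k l ^+ 4 / y ^+ 3))//; last by rewrite lerDr ltW.
    rewrite ler_pdivlMr ?exprn_gt0//.
    rewrite -(ger0_norm (z40 k l)) normrX [leRHS]exprS.
    by rewrite ler_wpM2l// lerXn2r// ?nnegrE ltW.
  have : m * x <= e * m * F 0%N 0%N
      + C * (D * n.+1).+1%:R / (e * m) ^+ 3 * (7 * m ^+ 2).
    apply: (le_trans mx); rewrite -(binsum_harmonic n.+1 _ hF).
    rewrite -binsumZ.
    have c0 : 0 <= C * (D * n.+1).+1%:R / (e * m) ^+ 3.
      by rewrite divr_ge0// mulr_ge0.
    have c4 := ler_wpM2l c0 (binsum_centred4_le _ _ u0 v0 uv n.+1).
    apply: le_trans (lerD (lexx _) c4).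
    rewrite -binsumZ -binsumD; apply: ler_binsum => k l kl.
    apply: (le_trans (ler_wpM2r (F0 k l) (zle k l))).
    rewrite mulrDl lerD2l.
    have z4 : 0 <= z k l ^+ 4 / (e * m) ^+ 3.
      by rewrite divr_ge0.
    apply: (le_trans (ler_wpM2l z4 (FC k l))).
    by rewrite kl le_eqVlt; apply/orP; left; apply/eqP; rewrite -/(z k l); ring.
  move=> mx4; rewrite -(ler_pM2l m0); apply: (le_trans mx4).
  rewrite [leRHS]mulrDr (mulrA m e) (mulrC m e) lerD2l.
  have -> : m * (7 * C * D.+1%:R / e ^+ 3 / m) = 7 * C / e ^+ 3 * D.+1%:R.
    by field; rewrite ?gt_eqF.
  have -> : C * (D * n.+1).+1%:R / (e * m) ^+ 3 * (7 * m ^+ 2) =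
      7 * C / e ^+ 3 * ((D * n.+1).+1%:R / m).
    by field; rewrite ?gt_eqF.
  have e30 : 0 <= e ^+ 3 by rewrite exprn_ge0// ltW.
  rewrite ler_wpM2l//; first by rewrite divr_ge0// mulr_ge0.
  by rewrite ler_pdivrMr// -natrM ler_nat mulSn addnC -addn1 leq_add2l.
apply/ler_addgt0Pl => d d0; rewrite addr0.
(* Here [e * F 0 0 + e = d], and taking [n] past [A / e] makes the second term of [key] at most
   [e]. *)
pose e := d / (F 0%N 0%N + 1).
have F1 : 0 < F 0%N 0%N + 1 by rewrite ltr_wpDl.
have e0 : 0 < e by rewrite divr_gt0.
pose A := 7 * C * D.+1%:R / e ^+ 3.
have A0 : 0 <= A by rewrite divr_ge0 ?exprn_ge0 ?(ltW e0)// mulr_ge0 ?mulr_ge0.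
have Ae0 : 0 <= A / e by rewrite divr_ge0// ltW.
apply: (le_trans (key e (Num.trunc (A / e)) e0)).
have -> : d = e * F 0%N 0%N + e.
  by rewrite -[X in _ + X]mulr1 -mulrDr divfK ?gt_eqF.
rewrite lerD2l -/A ler_pdivrMr ?ltr0n// mulrC -ler_pdivrMr//.
by have /andP[_ /ltW] := truncn_itv Ae0.
Qed.

Lemma exprn_lt_eps (x e : R) : 0 <= x -> x < 1 -> 0 < e ->
  exists n, x ^+ n < e.
Proof.
move=> x0 x1 e0.
have /cvgrPdist_lt/(_ e e0)[n _ /(_ n (leqnn _))] :
    x ^+ n @[n --> \oo] --> (0 : R) by apply: cvg_expr; rewrite ger0_norm.
by rewrite /= sub0r normrN ger0_norm ?exprn_ge0//; exists n.
Qed.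

Lemma ler_mulXX (a b a' b' : R) k l : 0 <= a -> 0 <= b -> a <= a' -> b <= b' ->
  a ^+ k * b ^+ l <= a' ^+ k * b' ^+ l.
Proof.
move=> a0 b0 aa' bb'; have a'0 := le_trans a0 aa'; have b'0 := le_trans b0 bb'.
by apply: ler_pM; rewrite ?exprn_ge0// lerXn2r.
Qed.

(* Along a path whose weights stay at least 1, each step multiplies the scale
   [a ^+ k * b ^+ l] by [a] or [b], hence by at least [m]. *)
Lemma near_mode_scale (a b u v m s : R) :
    0 < a < 1 -> 0 < b < 1 -> 0 < u -> 0 < v -> u + v = 1 ->
    m <= a -> m <= b -> 0 < s <= 1 ->
  exists k l, [/\ 1 <= (k + l).+1%:R * 'C(k + l, k)%:R * (u ^+ k * v ^+ l),
    s <= a ^+ k * b ^+ l & m * (a ^+ k * b ^+ l) < s].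
Proof.
move=> /andP[a0 a1] /andP[b0 b1] u0 v0 uv ma mb /andP[s0 s1].
pose w k l : R := (k + l).+1%:R * 'C(k + l, k)%:R * (u ^+ k * v ^+ l).
pose P k l := [/\ 1 <= w k l, s <= a ^+ k * b ^+ l
  & m * (a ^+ k * b ^+ l) < s].
have ab0 k l : 0 <= a ^+ k * b ^+ l by rewrite mulr_ge0// exprn_ge0// ltW.
(* The walk follows non-decreasing weights and stops just before the scale would drop below [s]. It
   cannot run forever: after [N] steps the scale is at most [c ^+ N]. *)
suff walk N : (exists k l, P k l) \/
    (exists k l, [/\ (k + l = N)%N, 1 <= w k l & s <= a ^+ k * b ^+ l]).
  pose c := Num.max a b.
  have [||N cN] := @exprn_lt_eps c s _ _ s0.
  - by rewrite le_max ltW.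
  - by rewrite gt_max a1.
  have [//|[k [l [kl _]]]] := walk N.
  rewrite leNgt (le_lt_trans _ cN)// -kl exprD.
  by rewrite ler_mulXX ?(ltW a0) ?(ltW b0)// le_max lexx ?orbT.
elim: N => [|N [|[k [l [kl w1 sab]]]]]; [|by left|].
  by right; exists 0%N, 0%N; rewrite /w !expr0 !mulr1.
have [wS|wS] := bin_weight_step u v u0 v0 uv k l.
- have [sab'|sab'] := leP s (a ^+ k.+1 * b ^+ l).
    by right; exists k.+1, l; rewrite addSn kl (le_trans w1).
  left; exists k, l; split=> //; apply: le_lt_trans sab'.
  by rewrite exprS -mulrA ler_wpM2r.
- have [sab'|sab'] := leP s (a ^+ k * b ^+ l.+1).
    by right; exists k, l.+1; rewrite addnS kl (le_trans w1).
  left; exists k, l; split=> //; apply: le_lt_trans sab'.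
  by rewrite exprS [leRHS]mulrCA ler_wpM2r.
Qed.

Lemma powRX (x p : R) n : 0 <= x -> (x ^+ n) `^ p = (x `^ p) ^+ n.
Proof.
move=> x0; elim: n => [|n IHn]; first by rewrite !expr0 powR1.
by rewrite !exprS powRM ?exprn_ge0// IHn.
Qed.

(** It remains to prove the growth bound for [F t]: a value at scale [s] is viewed from another base
    point, where it sits near the mode and has a large binomial coefficient. *)
Lemma deny_two_scales (a b p : R) (f : R -> R) :
    0 < a < 1 -> 0 < b < 1 -> 0 <= p -> a `^ p + b `^ p = 1 ->
    continuous f -> (forall t, 0 <= f t) ->
    (forall t, f t = f (a * t) + f (b * t)) ->
  forall t, f (a * t) = a `^ p * f t.
Proof.
move=> a01 b01 p0 ab1 fc f0 fab t.
have /andP[a0 a1] := a01; have /andP[b0 b1] := b01.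
have u0 := powR_gt0 p a0; have v0 := powR_gt0 p b0.
pose F x k l := f (a ^+ k * b ^+ l * x).
have hF x : lattice_harmonic (F x).
  by move=> k l; rewrite /F fab !exprS; congr (f _ + f _); ring.
have [M M0 fM] : exists2 M, 0 <= M & forall x, 0 <= x <= 1 -> f (x * t) <= M.
  have [||y _ fy] := @EVT_max R (fun x => f (x * t)) 0 1.
  - exact: ler01.
  - apply: continuous_subspaceT => x.
    by apply: continuous_comp; [exact: mulrr_continuous|exact: fc].
  - by exists (f (y * t)) => // x x01; apply: fy; rewrite in_itv.
pose m := Num.min a b; pose c := Num.max a b.
have m0 : 0 < m by rewrite lt_min a0.
have c0 : 0 < c by rewrite lt_max a0.
have c1 : c < 1 by rewrite gt_max a1.
have [ma mb] : m <= a /\ m <= b by rewrite !ge_min !lexx orbT.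
have [ac bc] : a <= c /\ b <= c by rewrite !le_max !lexx orbT.
(* [D] bounds the path length: [m ^+ (i + j) <= s <= c ^+ (k + l)] and [c ^+ D < m] give
   [k + l <= D * (i + j)]. *)
have [D cD] := exprn_lt_eps c m (ltW c0) c1 m0.
have growth i j : F t i j <=
    M / m `^ p * (D * (i + j)).+1%:R * ((a `^ p) ^+ i * (b `^ p) ^+ j).
  pose s := a ^+ i * b ^+ j.
  have s01 : 0 < s <= 1.
    rewrite mulr_gt0 ?exprn_gt0//=.
    by rewrite mulr_ile1 ?exprn_ge0 ?exprn_ile1 ?(ltW a0) ?(ltW b0)// ltW.
  have /andP[s0 s1] := s01.
  have [k [l [kl1 sab mabs]]] :=
    @near_mode_scale a b _ _ m s a01 b01 u0 v0 ab1 ma mb s01.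
  pose e := a ^+ k * b ^+ l.
  have e0 : 0 < e by rewrite mulr_gt0 ?exprn_gt0.
  have ep k' l' : (a ^+ k' * b ^+ l') `^ p = (a `^ p) ^+ k' * (b `^ p) ^+ l'.
    by rewrite powRM ?exprn_ge0 ?ltW// !powRX ?ltW.
  have kln : (k + l <= D * (i + j))%N.
    rewrite leqNgt; apply/negP => lt_kl.
    suff : s < s by rewrite ltxx.
    apply: (le_lt_trans sab); apply: (@le_lt_trans _ _ (c ^+ (k + l))).
      by rewrite exprD ler_mulXX// ltW.
    apply: (@lt_le_trans _ _ (c ^+ (D * (i + j)))).
      by rewrite ltr_iXn2l.
    apply: (@le_trans _ _ (m ^+ (i + j))).
      by rewrite exprM lerXn2r ?nnegrE ?exprn_ge0 ?(ltW c0) ?(ltW m0)// ltW.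
    by rewrite exprD ler_mulXX// ltW.
  (* Rebasing the lattice at [s / e * t] puts [F t i j] at the position [(k, l)], and the new base
     value is at most [M]. *)
  have se : 0 <= s / e <= 1.
    by rewrite (divr_ge0 (ltW s0) (ltW e0))/= ler_pdivrMr ?mul1r.
  have := harmonic_bin_le _ k l (hF (s / e * t)) (fun _ _ => f0 _).
  have -> : F (s / e * t) 0%N 0%N = f (s / e * t) by rewrite /F !expr0 !mul1r.
  have -> : F (s / e * t) k l = F t i j.
    by rewrite /F -/e -/s mulrA; congr (f (_ * t)); rewrite mulrC divfK ?gt_eqF.
  move=> /le_trans /(_ (fM _ se)) CF.
  have F0 : 0 <= F t i j by exact: f0.
  have w0 : 0 <= (a `^ p) ^+ k * (b `^ p) ^+ l.
    by rewrite mulr_ge0// exprn_ge0// ltW.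
  apply: (@le_trans _ _ ((k + l).+1%:R *
      (M * ((a `^ p) ^+ k * (b `^ p) ^+ l)))).
    apply: (@le_trans _ _ ((k + l).+1%:R * (('C(k + l, k)%:R * F t i j) *
        ((a `^ p) ^+ k * (b `^ p) ^+ l)))).
      by have := ler_wpM2r F0 kl1; rewrite mul1r => /le_trans; apply;
        rewrite le_eqVlt; apply/orP; left; apply/eqP; ring.
    by rewrite ler_wpM2l// ler_wpM2r.
  rewrite -!ep -/e -/s.
  (* Stopping with [m * e < s] costs only a constant factor in passing from the weight at [(k, l)]
     to the weight at [(i, j)]. *)
  have eps : e `^ p <= s `^ p / m `^ p.
    rewrite ler_pdivlMr ?powR_gt0// -powRM ?(ltW e0) ?(ltW m0)//.
    rewrite ge0_ler_powR ?nnegrE//.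
    - by rewrite mulr_ge0// ltW.
    - exact: ltW.
    - by rewrite mulrC ltW.
  apply: (@le_trans _ _ ((D * (i + j)).+1%:R * (M * (s `^ p / m `^ p)))).
    rewrite ler_pM ?mulr_ge0 ?powR_ge0//; first by rewrite ler_nat.
    by rewrite ler_wpM2l.
  by rewrite le_eqVlt; apply/orP; left; apply/eqP; ring.
have := @harmonic_moderate_growth _ _ _ _ D u0 v0 ab1 (hF t)
  (fun _ _ => f0 _) growth.
by rewrite /F !expr1 !expr0 !mulr1 !mul1r.
Qed.

Lemma continuous_powR_exponent (a : R) : 0 < a -> continuous (powR a).
Proof.
move=> a0; have -> : powR a = expR \o (fun p => p * ln a).
  by apply/funext => p; rewrite /powR gt_eqF.
move=> p; apply: continuous_comp; last exact: continuous_expR.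
exact: mulrr_continuous.
Qed.

(** Intermediate values: the sum is 2 at [p = 0], which also excludes [p = 0], and at [p = n + n']
    both powers are at most 1/2. *)
Lemma powR_sum_eq1 (a b : R) : 0 < a < 1 -> 0 < b < 1 ->
  exists2 p, 0 < p & a `^ p + b `^ p = 1.
Proof.
move=> /andP[a0 a1] /andP[b0 b1].
have a2 : (0 : R) < 2^-1 by rewrite invr_gt0.
have [n an] := exprn_lt_eps _ _ (ltW a0) a1 a2.
have [n' bn] := exprn_lt_eps _ _ (ltW b0) b1 a2.
pose g (p : R) := a `^ p + b `^ p.
have gN : g (n + n')%:R <= 1.
  rewrite /g !powR_mulrn ?ltW// !exprD.
  have : a ^+ n * a ^+ n' <= a ^+ n.
    by rewrite ler_piMr ?exprn_ge0 ?exprn_ile1 ?ltW.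
  have : b ^+ n * b ^+ n' <= b ^+ n'.
    by rewrite ler_piMl ?exprn_ge0 ?exprn_ile1 ?ltW.
  by lra.
have g0 : g 0 = 2 by rewrite /g !powRr0.
have [|||p /itvP p0 gp] := @IVT R g 0 (n + n')%:R 1.
- exact: ler0n.
- apply: continuous_subspaceT => x.
  by apply: cvgD; exact: continuous_powR_exponent.
- by rewrite ge_min le_max g0 gN orbT ler1n.
exists p => //; rewrite lt_neqAle p0 andbT eq_sym; apply/eqP => pE.
by move: gp; rewrite pE g0 => /eqP; rewrite (eqr_nat R 2 1).
Qed.

End deny.

(** * Characteristic functions with a scaling relation *)

Section power_scaling.
Context {R : realType}.

(** If [p < q], the powers of [a ^+ n] with exponent [q - p] tend to 0 and eventually drop below
    [m / M]. *)
Lemma exponent_le (a m M p q : R) : 0 < a < 1 -> 0 < m ->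
  (forall n, m * (a ^+ n) `^ p <= M * (a ^+ n) `^ q) -> q <= p.
Proof.
move=> /andP[a0 a1] m0 mM; rewrite leNgt; apply/negP => pq.
have M0 : 0 < M.
  have := mM 0%N; rewrite expr0 !powR1 !mulr1; exact: lt_le_trans.
have x1 : a `^ (q - p) < 1.
  have -> : 1 = 1 `^ (q - p) :> R by rewrite powR1.
  by rewrite gt0_ltr_powR ?subr_gt0// nnegrE ltW.
have [n] := exprn_lt_eps _ _ (powR_ge0 _ _) x1 (divr_gt0 m0 M0).
apply/negP; rewrite -leNgt ler_pdivrMr//.
have an0 : 0 < a ^+ n by rewrite exprn_gt0.
rewrite -powRX ?(ltW a0)// powRB ?gt_eqF ?implybT//.
by rewrite mulrAC ler_pdivlMr ?powR_gt0// [leRHS]mulrC mM.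
Qed.

Lemma continuous_powR_base (p t : R) : 0 < t ->
  {for t, continuous (fun x => x `^ p)}.
Proof.
move=> t0; apply/differentiable_continuous/derivable1_diffP.
by apply: derivable_powR; rewrite in_itv/= t0.
Qed.

(** The quotient [H] is invariant under [t -> a * t], so its extrema over the fundamental domain
    [[a, 1]] are bounds on all of [(0, 1]]. *)
Lemma power_scaling_bounds (a p : R) (f : R -> R) : 0 < a < 1 ->
    continuous f -> (forall t, t != 0 -> 0 < f t) ->
    (forall t, f (a * t) = a `^ p * f t) ->
  exists m M, 0 < m /\
    forall t, 0 < t <= 1 -> m * t `^ p <= f t <= M * t `^ p.
Proof.
move=> /andP[a0 a1] fc f0 fa.
pose H t := f t / t `^ p.
have Hc : {within `[a, 1], continuous H}.
  apply: continuous_in_subspaceT => t; rewrite inE/= in_itv/= => /andP[at1 _].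
  have t0 : 0 < t by exact: lt_le_trans at1.
  apply: cvgM; first exact: fc.
  apply: cvgV; first by rewrite gt_eqF ?powR_gt0.
  exact: continuous_powR_base.
have [y yI Hy] := EVT_min (ltW a1) Hc.
have [z zI Hz] := EVT_max (ltW a1) Hc.
have y0 : 0 < y by move: yI; rewrite in_itv/= => /andP[/(lt_le_trans a0)].
exists (H y), (H z); split; first by rewrite divr_gt0 ?powR_gt0 ?f0 ?gt_eqF.
move=> t /andP[t0 t1].
have exn : exists n, a ^+ n < t by exact: exprn_lt_eps (ltW a0) a1 t0.
(* The least exponent is a successor because [t <= 1]; its predecessor [n] satisfies
   [a ^+ n.+1 < t <= a ^+ n]. *)
case: (ex_minnP exn) => -[|n] ant nmin; first by rewrite ltNge t1 in ant.
have an0 : 0 < a ^+ n by rewrite exprn_gt0.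
have tan : t <= a ^+ n by rewrite leNgt; apply/negP => /nmin; rewrite ltnn.
have xI : t / a ^+ n \in `[a, 1].
  by rewrite in_itv/= ler_pdivlMr// -exprS (ltW ant) ler_pdivrMr ?mul1r.
have fan k x : f (a ^+ k * x) = (a ^+ k) `^ p * f x.
  elim: k => [|k IHk]; first by rewrite powR1 !mul1r.
  by rewrite exprS -mulrA fa IHk mulrA -powRM ?exprn_ge0 ?ltW.
have -> : f t = H (t / a ^+ n) * t `^ p.
  set x := t / a ^+ n; have x0 : 0 < x by rewrite divr_gt0.
  have -> : t = a ^+ n * x by rewrite mulrC divfK ?gt_eqF.
  rewrite fan powRM ?(ltW an0) ?(ltW x0)// /H.
  by field; rewrite gt_eqF ?powR_gt0.
by rewrite !ler_pM2r ?powR_gt0// Hy ?Hz.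
Qed.

End power_scaling.

(** * Characteristic functions that factor into rescaled copies of themselves *)

Section scaled_products.
Context {R : realType}.
Implicit Types phi : R -> R.

Lemma char_fun_near0_gt0 {phi} : is_real_char_fun phi ->
  \forall t \near 0, 0 < phi t.
Proof.
move=> phiC.
have : phi t @[t --> 0] --> phi 0 by exact: char_fun_continuous.
by rewrite (char_fun0 phiC) => /cvgr_gt /(_ 0 ltr01).
Qed.

Lemma char_fun_norm_ge1_trivial {phi} : is_real_char_fun phi ->
  (forall t, 1 <= `|phi t|) -> forall t, phi t = 1.
Proof.
move=> phiC phi1; apply: char_fun_near0_trivial => //.
apply: filterS (char_fun_near0_gt0 phiC) => t phit0.
by apply/eqP; rewrite eq_le -[phi t]gtr0_norm// phi1 char_fun_norm_le1.
Qed.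

(** If [a = 1], cancelling [phi] near 0 leaves the other factor equal to 1 there. If [a > 1], then
    [|phi (t / a)| <= |phi t|], and iterating gives [1 = |phi 0| <= |phi t|]. *)
Lemma scaled_product_ge1_trivial {phi} (a b : R) : is_real_char_fun phi ->
    1 <= a -> 0 < b -> (forall t, phi t = phi (a * t) * phi (b * t)) ->
  forall t, phi t = 1.
Proof.
move=> phiC a1 b0 phiab; have a0 : 0 < a by exact: lt_le_trans a1.
have [aE|aN1] := eqVneq a 1.
  apply: char_fun_near0_trivial => //.
  have tb : t / b @[t --> (0 : R)] --> (0 : R).
    by rewrite -[X in _ --> X](mul0r b^-1); exact: mulrr_continuous.
  have phib : \forall t \near (0 : R), 0 < phi (t / b).
    exact: tb _ (char_fun_near0_gt0 phiC).
  apply: filterS phib => t phi0.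
  have := phiab (t / b); rewrite aE mul1r (mulrC b) divfK ?gt_eqF//.
  by rewrite -{1}[phi (t / b)]mulr1 => /(mulfI (lt0r_neq0 phi0)).
apply: char_fun_norm_ge1_trivial => // t.
have ai1 : a^-1 < 1 by rewrite invf_lt1// lt_neqAle eq_sym aN1.
have mono n : `|phi ((a^-1) ^+ n * t)| <= `|phi t|.
  elim: n => [|n IHn]; first by rewrite mul1r.
  apply: le_trans IHn; rewrite exprS -mulrA phiab mulVKf ?gt_eqF// normrM.
  by rewrite ler_piMr// char_fun_norm_le1.
have : `|phi ((a^-1) ^+ n * t)| @[n --> \oo] --> `|phi 0|.
  apply: cvg_norm; apply: (@cvg_comp _ _ _ _ phi _ (nbhs (0 : R))).
    rewrite -(mul0r t); apply: cvgMl.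
    by apply: cvg_expr; rewrite gtr0_norm ?invr_gt0.
  exact: char_fun_continuous.
rewrite char_fun0// normr1 => phi_to1; rewrite leNgt; apply/negP => phi1.
have [N _ /(_ N (leqnn N))] := cvgr_gt _ phi_to1 _ phi1.
by rewrite /= ltNge mono.
Qed.

(** A non-positive value passes to one of the two factors, hence to arbitrarily small arguments,
    where [phi] is positive. *)
Lemma scaled_product_gt0 {phi} (a b : R) : is_real_char_fun phi ->
    0 < a < 1 -> 0 < b < 1 ->
    (forall t, phi t = phi (a * t) * phi (b * t)) ->
  forall t, 0 < phi t.
Proof.
move=> phiC /andP[a0 a1] /andP[b0 b1] phiab t.
rewrite ltNge; apply/negP => phit.
have /nbhs_ballP[e /= e0 phie] := char_fun_near0_gt0 phiC.
pose c := Num.max a b.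
have c1 : c < 1 by rewrite gt_max a1.
have [ac bc] : a <= c /\ b <= c by rewrite !le_max !lexx orbT.
have c0 : 0 <= c by rewrite (le_trans _ ac)// ltW.
have t0 : 0 < `|t| + 1 by rewrite ltr_wpDl.
have [n cn] := exprn_lt_eps _ _ c0 c1 (divr_gt0 e0 t0).
have [k [l [kl]]] : exists k l, (k + l = n)%N /\ phi (a ^+ k * b ^+ l * t) <= 0.
  elim: {cn} n => [|n [k [l [kl phikl]]]].
    by exists 0%N, 0%N; rewrite !mul1r.
  set x := a ^+ k * b ^+ l * t in phikl.
  have [xa|xa] := leP (phi (a * x)) 0.
    by exists k.+1, l; split; [rewrite addSn kl|rewrite exprS -!(mulrA a)].
  have [xb|xb] := leP (phi (b * x)) 0.
    exists k, l.+1; split; first by rewrite addnS kl.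
    by rewrite exprS (mulrCA (a ^+ k)) -mulrA.
  by move: phikl; rewrite phiab leNgt mulr_gt0.
apply/negP; rewrite -ltNge; apply: phie; rewrite /= /ball/= sub0r normrN.
rewrite normrM ger0_norm ?mulr_ge0 ?exprn_ge0 ?ltW//.
apply: (@le_lt_trans _ _ (c ^+ n * (`|t| + 1))).
  by rewrite -kl exprD ler_pM ?lerDl ?ler_mulXX ?mulr_ge0 ?exprn_ge0
    ?(ltW a0) ?(ltW b0).
by rewrite -ltr_pdivlMr.
Qed.

(** If [c = 0], the product is identically 1, so [|phi| >= 1]; a ratio [r / c] or [s / c] of at
    least 1 is excluded by [scaled_product_ge1_trivial]. *)
Lemma char_fun_product_scales {phi} (r s c : R) : is_real_char_fun phi ->
    ~ (forall t, phi t = 1) -> 0 < r -> 0 < s -> 0 <= c ->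
    (forall t, phi (r * t) * phi (s * t) = phi (c * t)) ->
  [/\ 0 < c, 0 < r / c < 1, 0 < s / c < 1
    & forall t, phi t = phi (r / c * t) * phi (s / c * t)].
Proof.
move=> phiC phiN r0 s0; rewrite le_eqVlt => /predU1P[<-|c0] phirs.
  exfalso; apply/phiN/char_fun_norm_ge1_trivial => // t.
  have := phirs (t / r); rewrite mul0r char_fun0// mulrC (mulrC r).
  rewrite divfK ?gt_eqF// => phi1.
  rewrite -[leLHS](normr1 R) -phi1 normrM.
  by rewrite ler_piMl// char_fun_norm_le1.
have phiab t : phi t = phi (r / c * t) * phi (s / c * t).
  rewrite -!mulrA phirs mulrA divff ?mul1r// gt_eqF//.
have phiba t : phi t = phi (s / c * t) * phi (r / c * t) by rewrite mulrC.
split=> //.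
- rewrite divr_gt0//= ltNge; apply/negP => rc; apply: phiN.
  by apply: (scaled_product_ge1_trivial _ _ phiC rc _ phiab); rewrite divr_gt0.
- rewrite divr_gt0//= ltNge; apply/negP => sc; apply: phiN.
  by apply: (scaled_product_ge1_trivial _ _ phiC sc _ phiba); rewrite divr_gt0.
Qed.

Lemma lnN_char_fun_continuous {phi} : is_real_char_fun phi ->
  (forall t, 0 < phi t) -> continuous (fun t => - ln (phi t)).
Proof.
move=> phiC phi0 t; apply: cvgN.
apply: continuous_comp; first exact: char_fun_continuous.
exact: continuous_ln.
Qed.

Lemma lnN_char_fun_ge0 {phi} : is_real_char_fun phi ->
  forall t, 0 <= - ln (phi t).
Proof.
move=> phiC t; rewrite oppr_ge0 ln_le0//.
by rewrite (le_trans (ler_norm _))// char_fun_norm_le1.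
Qed.

(** A zero at [t != 0] means [phi t = 1], and the scaling relation carries this property from [x] to
    [a * x]. *)
Lemma lnN_char_fun_gt0 {phi} (a p : R) : is_real_char_fun phi ->
    ~ (forall t, phi t = 1) -> (forall t, 0 < phi t) -> 0 < a < 1 ->
    (forall t, - ln (phi (a * t)) = a `^ p * - ln (phi t)) ->
  forall t, t != 0 -> 0 < - ln (phi t).
Proof.
move=> phiC phiN phi0 /andP[a0 a1] phia t t0.
rewrite lt_neqAle lnN_char_fun_ge0// andbT eq_sym; apply/eqP => lnphi.
apply: phiN; apply: (char_fun_eq1_scaled a t) => //.
  by apply: ln_inj; rewrite ?posrE// ln1 -[LHS]opprK lnphi oppr0.
move=> x phix; apply: ln_inj; rewrite ?posrE// ln1 -[LHS]opprK phia phix ln1.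
by rewrite oppr0 mulr0 oppr0.
Qed.

Lemma lnN_char_fun_scaling {phi} (a b : R) : is_real_char_fun phi ->
    0 < a < 1 -> 0 < b < 1 -> (forall t, 0 < phi t) ->
    (forall t, phi t = phi (a * t) * phi (b * t)) ->
  exists2 p, 0 < p &
    forall t, - ln (phi (a * t)) = a `^ p * - ln (phi t) /\
              - ln (phi (b * t)) = b `^ p * - ln (phi t).
Proof.
move=> phiC a01 b01 phi0 phiab.
have [p p0 pab] := powR_sum_eq1 a b a01 b01.
have fab t : - ln (phi t) = - ln (phi (a * t)) + - ln (phi (b * t)).
  by rewrite {1}phiab lnM ?posrE// opprD.
have fc := lnN_char_fun_continuous phiC phi0.
have f0 := lnN_char_fun_ge0 phiC.
exists p => // t; split.
  exact: (deny_two_scales a b p _ a01 b01 (ltW p0) pab fc f0 fab).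
apply: (deny_two_scales b a p _ b01 a01 (ltW p0) _ fc f0).
  by rewrite addrC.
by move=> x; rewrite addrC.
Qed.

(** Near 0, [- ln phi] is comparable to both powers, which are therefore comparable to each
    other. *)
Lemma lnN_char_fun_exponent_unique {phi} (a b p q : R) :
    is_real_char_fun phi -> ~ (forall t, phi t = 1) -> (forall t, 0 < phi t) ->
    0 < a < 1 -> 0 < b < 1 ->
    (forall t, - ln (phi (a * t)) = a `^ p * - ln (phi t)) ->
    (forall t, - ln (phi (b * t)) = b `^ q * - ln (phi t)) ->
  p = q.
Proof.
move=> phiC phiN phi0 a01 b01 fa fb.
have fc := lnN_char_fun_continuous phiC phi0.
have f0 := lnN_char_fun_gt0 a p phiC phiN phi0 a01 fa.
have [m [M [m0 mM]]] := power_scaling_bounds a p _ a01 fc f0 fa.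
have [m' [M' [m'0 mM']]] := power_scaling_bounds b q _ b01 fc f0 fb.
have /andP[a0 a1] := a01.
have an01 n : 0 < a ^+ n <= 1 by rewrite exprn_gt0//= exprn_ile1 ?ltW.
apply/eqP; rewrite eq_le; apply/andP; split.
  apply: (exponent_le a m' M _ _ a01 m'0) => n.
  have /andP[_ fM] := mM _ (an01 n); have /andP[mf _] := mM' _ (an01 n).
  exact: le_trans mf fM.
apply: (exponent_le a m M' _ _ a01 m0) => n.
have /andP[mf _] := mM _ (an01 n); have /andP[_ fM] := mM' _ (an01 n).
exact: le_trans mf fM.
Qed.

(** Halving [n] times gives [1 - phi (2^-n) >= 4^-n * (1 - phi 1)], while [1 - phi <= - ln phi] is
    at most [M] times the [p]-th power of [2^-n]. *)
Lemma lnN_char_fun_exponent_le2 {phi} (a p : R) :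
    is_real_char_fun phi -> ~ (forall t, phi t = 1) -> (forall t, 0 < phi t) ->
    0 < a < 1 -> (forall t, - ln (phi (a * t)) = a `^ p * - ln (phi t)) ->
  p <= 2.
Proof.
move=> phiC phiN phi0 a01 fa.
have fc := lnN_char_fun_continuous phiC phi0.
have f0 := lnN_char_fun_gt0 a p phiC phiN phi0 a01 fa.
have [m [M [m0 mM]]] := power_scaling_bounds a p _ a01 fc f0 fa.
have h01 : 0 < (2^-1 : R) < 1 by rewrite invr_gt0 ltr0n/= invf_lt1// ltr1n.
have /andP[h0 h1] := h01.
have phi1 : 0 < 1 - phi 1.
  rewrite subr_gt0 ltNge; apply/negP => /ln_ge0.
  by apply/negP; rewrite -ltNge -oppr_gt0 f0// oner_neq0.
apply: (exponent_le 2^-1 (1 - phi 1) M 2 p h01 phi1) => n.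
have hn01 : 0 < (2^-1 : R) ^+ n <= 1 by rewrite exprn_gt0//= exprn_ile1 ?ltW.
have /andP[_ ] := mM _ hn01; apply: le_trans.
have phi_ln x : 1 - phi x <= - ln (phi x).
  have := @le_ln1Dx R (phi x - 1).
  rewrite ltrBrDl subrr addrC subrK => /(_ (phi0 x)).
  by lra.
apply: le_trans (phi_ln _); rewrite powR_mulrn ?exprn_ge0 ?(ltW h0)//.
elim: n {hn01} => [|n IHn]; first by rewrite !expr0 expr1n mulr1.
have := one_sub_char_funD_le phiC (2^-1 ^+ n.+1) (2^-1 ^+ n.+1).
have -> : 2^-1 ^+ n.+1 + 2^-1 ^+ n.+1 = 2^-1 ^+ n :> R by rewrite exprS; lra.
move=> /(le_trans IHn); rewrite (exprS _ n) exprMn.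
by move: (phi (_ * _)) (_ ^+ n ^+ 2) => x y; lra.
Qed.

End scaled_products.

(** * Construction of the exponent [p] and of the functions [H] and [K] *)

Theorem theorem4 (R : realType) (c d : R -> R -> R)
  (c_ge0 : forall r s : R, 0 <= r -> 0 <= s -> 0 <= c r s)
  (d_ge0 : forall r s : R, 0 <= r -> 0 <= s -> 0 <= d r s)
  (Z_neq0 : zero_locus d !=set0)
  (Z_neqT : zero_locus d <> @quadrant R)
  (phi psi : R -> R)
  (phi_char : is_real_char_fun phi)
  (psi_char : is_real_char_fun psi)
  (phi_nontriv : ~ (forall t : R, phi t = 1))
  (psi_nontriv : ~ (forall t : R, psi t = 1))
  (phi_psi : forall r s t : R, 0 <= r -> 0 <= s ->
    phi (r * t) * phi (s * t) = phi (c r s * t) * psi (d r s * t)) :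
  exists (p : R) (H K : R -> R),
    [/\ 0 < p <= 2,
        [/\ forall t : R, t != 0 -> 0 < H t,
            forall t : R, t != 0 -> H (- t) = H t
          & forall t : R, t != 0 -> {for t, continuous H}],
        [/\ forall t : R, t != 0 -> 0 < K t,
            forall t : R, t != 0 -> K (- t) = K t
          & forall t : R, t != 0 -> {for t, continuous K}]
      & [/\ forall t : R, t != 0 ->
              phi t = expR (- (`|t| `^ p * H t)) /\
              psi t = expR (- (`|t| `^ p * K t)),
            forall r s : R, (r, s) \in zero_locus d ->
              0 < c r s /\
              forall t : R, t != 0 ->
                [/\ H (r * t) = H (s * t), H (s * t) = H (c r s * t),
                    K (r * t) = K (s * t) & K (s * t) = K (c r s * t)]
          & forall r s t : R, t != 0 -> 0 < r -> 0 < s -> 0 < c r s ->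
              (r, s) \notin zero_locus d ->
              r `^ p * H (r * t) + s `^ p * H (s * t) =
              c r s `^ p * H (c r s * t) + d r s `^ p * K (d r s * t)]].
Proof.
have phiprod r s : (r, s) \in zero_locus d ->
  [/\ 0 < r, 0 < s, 0 <= c r s
    & forall t, phi (r * t) * phi (s * t) = phi (c r s * t)].
  rewrite inE => -[[/= r0 s0] d0]; split=> //; first by rewrite c_ge0// ltW.
  by move=> t; rewrite phi_psi ?ltW// d0 mul0r (char_fun0 psi_char) mulr1.
have scales r s : (r, s) \in zero_locus d -> [/\ 0 < c r s,
    0 < r / c r s < 1, 0 < s / c r s < 1
  & forall t, phi t = phi (r / c r s * t) * phi (s / c r s * t)].
  by move=> /phiprod[r0 s0 c0]; exact: char_fun_product_scales.
have [[r0 s0] /mem_set rs0] := Z_neq0.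
have [c0 a01 b01 phiab] := scales _ _ rs0.
set a := r0 / _ in a01 phiab; set b := s0 / _ in b01 phiab.
have phi_gt0 := scaled_product_gt0 a b phi_char a01 b01 phiab.
pose f t := - ln (phi t).
have [p p0 fab] := lnN_char_fun_scaling a b phi_char a01 b01 phi_gt0 phiab.
have fa t : f (a * t) = a `^ p * f t by case: (fab t).
have f_gt0 := lnN_char_fun_gt0 a p phi_char phi_nontriv phi_gt0 a01 fa.
(* Each point of the zero locus has its own exponent [q]; uniqueness identifies it with the [p] of
   the chosen point. *)
have fscale r s : (r, s) \in zero_locus d -> forall t,
    f (r / c r s * t) = (r / c r s) `^ p * f t /\
    f (s / c r s * t) = (s / c r s) `^ p * f t.
  move=> /scales[_ r01 s01 phirs].
  have [q _ fq] := lnN_char_fun_scaling _ _ phi_char r01 s01 phi_gt0 phirs.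
  suff -> : p = q by exact: fq.
  apply: (lnN_char_fun_exponent_unique _ _ p q phi_char phi_nontriv phi_gt0
    a01 r01 fa) => t.
  by case: (fq t).
have [r1 [s1 [r1_gt0 s1_gt0 d1]]] : exists r s, [/\ 0 < r, 0 < s & 0 < d r s].
  apply: contrapT => noZ; apply: Z_neqT; apply/seteqP; split=> [[r s] []//|].
  move=> [r s] [/= r_gt0 s_gt0]; split=> //=; apply/eqP.
  rewrite eq_le (d_ge0 _ _ (ltW r_gt0) (ltW s_gt0)) andbT leNgt.
  apply/negP => d_gt0.
  by apply: noZ; exists r, s.
have c1 : 0 <= c r1 s1 by rewrite c_ge0// ltW.
have psi_gt0 t : 0 < psi t.
  have := phi_psi r1 s1 (t / d r1 s1) (ltW r1_gt0) (ltW s1_gt0).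
  rewrite [d r1 s1 * _]mulrC divfK ?gt_eqF// => phipsi.
  rewrite -(pmulr_rgt0 _ (phi_gt0 (c r1 s1 * (t / d r1 s1)))).
  by rewrite -phipsi mulr_gt0.
pose g t := - ln (psi t).
have fg r s t : 0 <= r -> 0 <= s ->
    f (r * t) + f (s * t) = f (c r s * t) + g (d r s * t).
  move=> r_ge0 s_ge0; rewrite /f /g -!opprD -!lnM ?posrE//.
  by rewrite phi_psi.
(* Solving the equation at [(r1, s1)], where [d r1 s1 > 0], writes [g] as a fixed linear combination
   of dilates of [f], and every scaling relation of [f] passes through it. *)
have gscale x : (forall t, f (x * t) = x `^ p * f t) ->
    forall t, g (x * t) = x `^ p * g t.
  move=> fx t; have gE y : g y = f (r1 * (y / d r1 s1)) + f (s1 * (y / d r1 s1))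
      - f (c r1 s1 * (y / d r1 s1)).
    rewrite fg ?ltW// [d r1 s1 * _]mulrC divfK ?gt_eqF//.
    by rewrite [RHS]addrAC subrr add0r.
  by rewrite !gE -(mulrA x) !(mulrCA _ x) !fx; ring.
have g_gt0 :=
  lnN_char_fun_gt0 a p psi_char psi_nontriv psi_gt0 a01 (gscale a fa).
have f_cont := lnN_char_fun_continuous phi_char phi_gt0.
have g_cont := lnN_char_fun_continuous psi_char psi_gt0.
(* Dividing by the power turns a relation for the scale [x] into invariance of [H] and [K] under
   [t -> x * t]. *)
pose H t := f t / `|t| `^ p; pose K t := g t / `|t| `^ p.
have np_gt0 (t : R) : t != 0 -> 0 < `|t| `^ p.
  by move=> t0; rewrite powR_gt0// normr_gt0.
have Hcont (h : R -> R) t : continuous h -> t != 0 ->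
    {for t, continuous (fun x => h x / `|x| `^ p)}.
  move=> hc t0; apply: cvgM; first exact: hc.
  apply: cvgV; first by rewrite gt_eqF ?np_gt0.
  apply: (@cvg_comp _ _ _ _ (fun y : R => y `^ p) _ (nbhs `|t|)).
    exact: norm_continuous.
  by apply: continuous_powR_base; rewrite normr_gt0.
(* The factor [x] cancels, so the last identity of the theorem becomes [fg] divided by a common
   power of [|t|]. *)
have HE (h : R -> R) x t : t != 0 -> 0 < x ->
    x `^ p * (h (x * t) / `|x * t| `^ p) = h (x * t) / `|t| `^ p.
  move=> t0 x0; rewrite normrM (gtr0_norm x0) powRM ?(ltW x0)//.
  by field; rewrite !gt_eqF ?np_gt0 ?powR_gt0.
have scaleE (h : R -> R) x t : t != 0 -> 0 < x ->
    (forall t, h (x * t) = x `^ p * h t) ->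
    h (x * t) / `|x * t| `^ p = h t / `|t| `^ p.
  move=> t0 x0 hx; rewrite hx normrM (gtr0_norm x0) powRM ?(ltW x0)//.
  by rewrite -mulf_div divff ?mul1r// gt_eqF ?powR_gt0.
exists p, H, K; split.
- rewrite p0/=.
  exact: (lnN_char_fun_exponent_le2 a p phi_char phi_nontriv phi_gt0 a01 fa).
- split=> t t0.
  + by rewrite divr_gt0 ?np_gt0 ?f_gt0.
  + by rewrite /H /f (char_funN phi_char) normrN.
  + exact: Hcont.
- split=> t t0.
  + by rewrite divr_gt0 ?np_gt0 ?g_gt0.
  + by rewrite /K /g (char_funN psi_char) normrN.
  + exact: Hcont.
split.
- move=> t t0; rewrite /H /K ![`|t| `^ p * _]mulrC !divfK ?gt_eqF ?np_gt0//.
  by rewrite !opprK !lnK ?posrE.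
- move=> r s rsZ.
  have [c_gt0 /andP[r_gt0 _] /andP[s_gt0 _] _] := scales _ _ rsZ.
  split=> // t t0.
  have ct0 : c r s * t != 0 by rewrite mulf_neq0 ?(gt_eqF c_gt0).
  (* Scaling is known for the ratios [r / c r s] and [s / c r s], so it is applied at the point
     [c r s * t]. *)
  have rE x : x * t = x / c r s * (c r s * t) by rewrite mulrA divfK ?gt_eqF.
  have fr u : f (r / c r s * u) = (r / c r s) `^ p * f u.
    by case: (fscale r s rsZ u).
  have fs u : f (s / c r s * u) = (s / c r s) `^ p * f u.
    by case: (fscale r s rsZ u).
  have Hr : H (r * t) = H (c r s * t) by rewrite rE; exact: scaleE.
  have Hs : H (s * t) = H (c r s * t) by rewrite rE; exact: scaleE.
  have Kr : K (r * t) = K (c r s * t).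
    by rewrite rE; apply: scaleE => //; exact: gscale.
  have Ks : K (s * t) = K (c r s * t).
    by rewrite rE; apply: scaleE => //; exact: gscale.
  by rewrite Hr Hs Kr Ks.
move=> r s t t0 r_gt0 s_gt0 c_gt0 rsZ.
have d_gt0 : 0 < d r s.
  rewrite lt_neqAle (d_ge0 _ _ (ltW r_gt0) (ltW s_gt0)) andbT eq_sym.
  apply/eqP => d0.
  by move/negP: rsZ; apply; rewrite inE.
by rewrite !HE// -!mulrDl fg ?ltW.
Qed.
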